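(* Let $\Sigma$ be a finite alphabet and let $L\subseteq\Sigma^*$ be a language in $\mathsf{AfL}$. Then there exists an affine finite automaton $\mathcal{B} = (E,\Sigma,\{B_x\}_{x\in\Sigma},\vec{v}_0,E_a)$ such that $L = \{w\in\Sigma^* : f_{\mathcal{B}}(w)>\frac12\}$ and such that each entry of the affine states during the computation is always in $[-1,1]$, i.e. for every $w\in\Sigma^*$ all entries of the vector $B_w\vec{v}_0$ lie in $[-1,1]$.
   Context: A real vector is affine if its coordinates sum to $1$; a real square matrix is affine if each of its columns is an affine vector. An affine finite automaton (AfA) over a finite alphabet $\Sigma$ is a tuple $A = (E, \Sigma, \{M_x\}_{x\in\Sigma}, \vec{v}_0, E_a)$, where $E=\{e_1,\dots,e_k\}$ is a finite set of states, each $M_x$ is a $k\times k$ real affine matrix, $\vec{v}_0\in\mathbb{R}^k$ is an affine vector (the initial state), and $E_a\subseteq E$ is the set of accepting states. For $w = w_1\cdots w_n\in\Sigma^*$ put $M_w = M_{w_n}\cdots M_{w_1}$ (the identity if $w$ is the empty word) and $\vec{v}_f = M_w\vec{v}_0$. The function $f_A:\Sigma^*\to[0,1]$ computed by $A$ is $$f_A(w) = \frac{\sum_{e_i\in E_a} |(\vec{v}_f)_i|}{\sum_{e_i\in E} |(\vec{v}_f)_i|}.$$ A language $L\subseteq\Sigma^*$ is recognized by $A$ with cutpoint $\lambda\in[0,1]$ if $L=\{w\in\Sigma^* : f_A(w)>\lambda\}$. $\mathsf{AfL}$ (the class of affine languages) is the class of languages recognized by some AfA with some cutpoint $\lambda\in[0,1]$.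 *)

(* Defs.v *)
(* MathComp world; the real numbers are an arbitrary R : realType. *)
From HB Require Import structures.
From mathcomp Require Import all_boot all_order all_algebra.
From mathcomp Require Import classical_sets reals.

Set Implicit Arguments.
Unset Strict Implicit.
Unset Printing Implicit Defensive.

Import Order.TTheory GRing.Theory Num.Theory.

Local Open Scope classical_set_scope.
Local Open Scope ring_scope.

Definition affine_vec (R : realType) (k : nat) (v : 'cV[R]_k) : Prop :=
  \sum_(i < k) v i 0 = 1.

Definition affine_mx (R : realType) (k : nat) (M : 'M[R]_k) : Prop :=
  forall j : 'I_k, affine_vec (col j M).

(* The state set {e_1, ..., e_k} is 'I_k; affinity of the initial vector
   forces k > 0. *)
Record AfA (R : realType) (Sigma : finType) := MkAfA {
  afa_dim : nat;
  afa_mx : Sigma -> 'M[R]_afa_dim;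
  afa_init : 'cV[R]_afa_dim;
  afa_acc : {set 'I_afa_dim};
  afa_mx_affine : forall x : Sigma, affine_mx (afa_mx x);
  afa_init_affine : affine_vec afa_init
}.

(* Matrices act on column vectors from the left, so the first letter of the
   word gives the rightmost factor: M_(w_1 ... w_n) = M_(w_n) ... M_(w_1). *)
Fixpoint afa_word_mx (R : realType) (Sigma : finType) (A : AfA R Sigma)
    (w : seq Sigma) : 'M[R]_(afa_dim A) :=
  if w is x :: w' then afa_word_mx A w' *m afa_mx A x else 1%:M.

Definition afa_state (R : realType) (Sigma : finType) (A : AfA R Sigma)
    (w : seq Sigma) : 'cV[R]_(afa_dim A) :=
  afa_word_mx A w *m afa_init A.

(* The denominator is at least 1, since the entries of the state sum to 1. *)
Definition afa_value (R : realType) (Sigma : finType) (A : AfA R Sigma)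
    (w : seq Sigma) : R :=
  (\sum_(i in afa_acc A) `|afa_state A w i 0|) /
  (\sum_(i < afa_dim A) `|afa_state A w i 0|).

Definition afa_lang (R : realType) (Sigma : finType) (A : AfA R Sigma)
    (lambda : R) : set (seq Sigma) :=
  [set w | lambda < afa_value A w].

Definition AfL (R : realType) (Sigma : finType) : set (set (seq Sigma)) :=
  [set L | exists (A : AfA R Sigma) (lambda : R),
     0 <= lambda <= 1 /\ L = afa_lang A lambda].

(* Main.v *)
(* Shrink every transition matrix by a constant c small enough that the
   computation vector y = c^(n+1) M_w v_0 stays in a small l1-ball.  Keep y
   in accepting states and (1 + lambda - [i accepting]) y_i in rejecting ones:
   the accepting mass minus the rejecting mass is then
   sum_i ([i accepting] - lambda) |y_i|, whose sign decides the language.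
   Two slack states, one accepting and one rejecting, share the missing mass
   equally; they restore affinity without affecting the cutpoint 1/2. *)
Require Import Defs.
From HB Require Import structures.
From mathcomp Require Import all_boot all_order all_algebra.
From mathcomp Require Import classical_sets reals.
From mathcomp Require Import ring lra zify.

Set Implicit Arguments.
Unset Strict Implicit.
Unset Printing Implicit Defensive.

Import Order.TTheory GRing.Theory Num.Theory.

Local Open Scope classical_set_scope.
Local Open Scope ring_scope.

Lemma mul_ones_affine (R : realType) k (v : 'cV[R]_k) :
  affine_vec v -> const_mx 1 *m v = const_mx 1 :> 'rV_1.
Proof.
move=> v1; apply/matrixP => i j; rewrite !mxE -[RHS]v1.
by apply: eq_bigr => l _; rewrite !mxE mul1r (ord1 j).
Qed.

Lemma affine_mulmx (R : realType) k (M : 'M[R]_k) (v : 'cV[R]_k) :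
  affine_mx M -> affine_vec v -> affine_vec (M *m v).
Proof.
move=> M1 v1; rewrite /affine_vec -[RHS]v1.
under eq_bigr do rewrite mxE.
rewrite exchange_big /=; apply: eq_bigr => j _.
rewrite -mulr_suml -[RHS]mul1r; congr (_ * _).
by rewrite -[RHS](M1 j); apply: eq_bigr => i _; rewrite mxE.
Qed.

Lemma affine_state (R : realType) (Sigma : finType) (A : AfA R Sigma) w :
  affine_vec (afa_state A w).
Proof.
rewrite /afa_state; move: (afa_init_affine A); move: (afa_init A).
elim: w => [|x w IH] v v1 /=; first by rewrite mul1mx.
by rewrite -mulmxA; apply: IH; apply: affine_mulmx => //; exact: afa_mx_affine.
Qed.

(** The denominator is at least the entry sum 1, so it can be cleared. What remains is the sign of a
    form that is homogeneous in the state, hence unchanged when the state is scaled by a positive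
    factor. *)
Lemma lt_afa_value (R : realType) (Sigma : finType) (A : AfA R Sigma)
    (lambda : R) w :
  (lambda < afa_value A w) =
  (0 < \sum_(i < afa_dim A) ((i \in afa_acc A)%:R - lambda)
         * `|afa_state A w i 0|).
Proof.
have den_gt0 : 0 < \sum_(i < afa_dim A) `|afa_state A w i 0|.
  apply: (lt_le_trans ltr01); rewrite -[leLHS](affine_state A w).
  by apply: ler_sum => i _; exact: ler_norm.
rewrite /afa_value ltr_pdivlMr // -subr_gt0 big_mkcond mulr_sumr -sumrB.
congr (_ < _); apply: eq_bigr => i _.
by case: ifP => _ /=; ring.
Qed.

Definition l1norm (R : realType) k (v : 'cV[R]_k) : R := \sum_i `|v i 0|.

(** A crude upper bound for the operator norm induced by [l1norm]. *)
Definition entry_sum (R : realType) k (M : 'M[R]_k) : R :=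
  \sum_i \sum_j `|M i j|.

Lemma l1norm_ge0 (R : realType) k (v : 'cV[R]_k) : 0 <= l1norm v.
Proof. by apply: sumr_ge0. Qed.

Lemma ler_l1norm (R : realType) k (v : 'cV[R]_k) i : `|v i 0| <= l1norm v.
Proof. by rewrite /l1norm (bigD1 i) //= lerDl; apply: sumr_ge0. Qed.

Lemma l1normZ (R : realType) k (c : R) (v : 'cV[R]_k) :
  l1norm (c *: v) = `|c| * l1norm v.
Proof. by rewrite /l1norm mulr_sumr; apply: eq_bigr => i _; rewrite mxE normrM. Qed.

Lemma entry_sum_ge0 (R : realType) k (M : 'M[R]_k) : 0 <= entry_sum M.
Proof. by apply: sumr_ge0 => i _; apply: sumr_ge0. Qed.

Lemma l1norm_mulmx (R : realType) k (M : 'M[R]_k) (v : 'cV[R]_k) :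
  l1norm (M *m v) <= entry_sum M * l1norm v.
Proof.
rewrite /entry_sum mulr_suml; apply: ler_sum => i _.
rewrite mxE (le_trans (ler_norm_sum _ _ _)) // mulr_suml.
apply: ler_sum => j _; rewrite normrM ler_wpM2l //; exact: ler_l1norm.
Qed.

(** Each added row is half of what the column sums lack to reach 1. Leaving [p] free lets one
    definition serve both transition matrices and states. *)
Definition balance (R : realType) m p (N : 'M[R]_(m, p)) : 'M[R]_(m + 2, p) :=
  col_mx N (const_mx (1 / 2) *m (const_mx 1 - const_mx 1 *m N : 'rV_p)).

Lemma balance_slack (R : realType) m p (N : 'M[R]_(m, p)) (s : 'I_2) j :
  balance N (rshift m s) j = (1 - \sum_i N i j) / 2.
Proof.
rewrite /balance col_mxEd mxE big_ord1 !mxE mul1r mulrC; congr ((1 - _) / 2).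
by apply: eq_bigr => i _; rewrite mxE mul1r.
Qed.

Lemma sum_balance (R : realType) m p (N : 'M[R]_(m, p)) j :
  \sum_i balance N i j = 1.
Proof.
rewrite big_split_ord /= !big_ord_recl big_ord0 !balance_slack.
under eq_bigr do rewrite col_mxEu.
by field.
Qed.

Lemma balance_affine_vec (R : realType) m (v : 'cV[R]_m) :
  affine_vec (balance v).
Proof. exact: sum_balance. Qed.

Lemma balance_affine_mx (R : realType) m (N : 'M[R]_(m, m + 2)) :
  affine_mx (balance N).
Proof.
move=> j; rewrite /affine_vec -[RHS](sum_balance N j).
by apply: eq_bigr => i _; rewrite mxE.
Qed.

(** On an affine [v] the all-ones row evaluates to 1, so the slack rows of [balance N] yield exactly
    the slack of [N *m v]. *)
Lemma balance_mul (R : realType) m p (N : 'M[R]_(m, p)) (v : 'cV[R]_p) :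
  affine_vec v -> balance N *m v = balance (N *m v).
Proof.
move=> v1; rewrite /balance mul_col_mx -mulmxA mulmxBl.
by rewrite (mul_ones_affine v1) -mulmxA.
Qed.

Section BalancedAutomaton.
Variables (R : realType) (Sigma : finType) (A : AfA R Sigma) (lambda : R).
Let k := afa_dim A.

(** Chosen so that 1 minus the weight is [(i \in afa_acc A)%:R - lambda]; for [lambda] in [0, 1] it
    lies in [0, 2], so it passes through absolute values. *)
Definition reject_weight (i : 'I_k) : R := 1 + lambda - (i \in afa_acc A)%:R.

Definition spread : 'M[R]_(k + k, k) :=
  col_mx 1%:M (diag_mx (\row_i reject_weight i)).

(** The first block stores [y] itself, so reading it off undoes both spreading and balancing. *)
Definition unspread : 'M[R]_(k, k + k + 2) := row_mx (row_mx 1%:M 0) 0.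

Lemma spreadEl y i : (spread *m y) (lshift k i) (0 : 'I_1) = y i 0.
Proof. by rewrite /spread mul_col_mx col_mxEu mul1mx. Qed.

Lemma spreadEr y i :
  (spread *m y) (rshift k i) (0 : 'I_1) = reject_weight i * y i 0.
Proof. by rewrite /spread mul_col_mx col_mxEd mul_diag_mx !mxE. Qed.

Lemma unspreadK (y : 'cV[R]_k) : unspread *m balance (spread *m y) = y.
Proof.
rewrite /unspread /balance mul_row_col mul0mx addr0 /spread mul_col_mx.
by rewrite mul_row_col mul0mx addr0 !mul1mx.
Qed.

(** One constant for all letters: the sum dominates each [entry_sum], the factor 3 yields the radius
    1/3, and the 1 keeps the inverted quantity positive. *)
Definition shrink : R :=
  (1 + 3 * l1norm (afa_init A) + \sum_x entry_sum (afa_mx A x))^-1.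

Let sum_ge0 : 0 <= \sum_x entry_sum (afa_mx A x).
Proof. by apply: sumr_ge0 => x _; exact: entry_sum_ge0. Qed.

Lemma shrink_gt0 : 0 < shrink.
Proof. by rewrite invr_gt0; have := l1norm_ge0 (afa_init A); move: sum_ge0; lra. Qed.

Lemma shrink_init : l1norm (shrink *: afa_init A) <= 1 / 3.
Proof.
rewrite l1normZ gtr0_norm ?shrink_gt0 // /shrink mulrC.
have := l1norm_ge0 (afa_init A); move: sum_ge0 => h1 h2.
by rewrite ler_pdivrMr; lra.
Qed.

Lemma shrink_mx x (y : 'cV[R]_k) :
  l1norm (shrink *: (afa_mx A x *m y)) <= l1norm y.
Proof.
rewrite l1normZ gtr0_norm ?shrink_gt0 //.
apply: (@le_trans _ _ (shrink * entry_sum (afa_mx A x) * l1norm y)).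
  by rewrite -mulrA ler_pM2l ?shrink_gt0 // l1norm_mulmx.
rewrite ler_piMl ?l1norm_ge0 // /shrink mulrC.
have := l1norm_ge0 (afa_init A); move: sum_ge0 => h1 h2.
have : entry_sum (afa_mx A x) <= \sum_x entry_sum (afa_mx A x).
  rewrite (bigD1 x) //= lerDl; apply: sumr_ge0 => z _; exact: entry_sum_ge0.
by rewrite ler_pdivrMr; lra.
Qed.

Definition balanced_mx x : 'M[R]_(k + k + 2) :=
  balance (shrink *: (spread *m afa_mx A x *m unspread)).

Definition balanced_init : 'cV[R]_(k + k + 2) :=
  balance (spread *m (shrink *: afa_init A)).

(* The accepting states are the first copy of the states of [A] and the first
   of the two slack states. *)
Definition balanced : AfA R Sigma :=
  @MkAfA R Sigma (k + k + 2) balanced_mx balanced_init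
    [set i : 'I_(k + k + 2) | (i < k)%N || (i == k + k :> nat)]%SET
    (fun x => balance_affine_mx _) (balance_affine_vec _).

Lemma balanced_step x (y : 'cV[R]_k) :
  balanced_mx x *m balance (spread *m y) =
  balance (spread *m (shrink *: (afa_mx A x *m y))).
Proof.
rewrite balance_mul; last exact: balance_affine_vec.
by rewrite -scalemxAl -!mulmxA unspreadK -scalemxAr.
Qed.

Lemma balanced_stateE w : exists c : R, exists y : 'cV[R]_k,
  [/\ 0 < c, y = c *: afa_state A w, l1norm y <= 1 / 3 &
      afa_state balanced w = balance (spread *m y)].
Proof.
(* The recursion on words puts the first letter next to the vector, so the induction must vary the
   initial vector and its scale. *)
suff gen (c : R) (v : 'cV[R]_k) : 0 < c -> l1norm (c *: v) <= 1 / 3 ->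
    exists d : R, exists y : 'cV[R]_k,
    [/\ 0 < d, y = d *: (afa_word_mx A w *m v), l1norm y <= 1 / 3 &
        afa_word_mx balanced w *m balance (spread *m (c *: v)) =
        balance (spread *m y)].
  by apply: gen; [exact: shrink_gt0 | exact: shrink_init].
elim: w c v => [|x w IH] c v c_gt0 cv /=.
  by exists c, (c *: v); rewrite !mul1mx.
have scE : shrink *: (afa_mx A x *m (c *: v)) =
    (shrink * c) *: (afa_mx A x *m v) by rewrite -scalemxAr scalerA.
rewrite -!mulmxA balanced_step scE; apply: IH.
  by rewrite mulr_gt0 ?shrink_gt0.
by rewrite -scE (le_trans (shrink_mx _ _)).
Qed.

Lemma balanced_margin w (y : 'cV[R]_k) :
  afa_state balanced w = balance (spread *m y) -> 0 <= lambda <= 1 ->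
  \sum_(i < afa_dim balanced) ((i \in afa_acc balanced)%:R - 1 / 2)
     * `|afa_state balanced w i 0| =
  1 / 2 * \sum_(i < k) ((i \in afa_acc A)%:R - lambda) * `|y i 0|.
Proof.
move=> -> /andP[l0 l1] /=.
rewrite big_split_ord /= big_split_ord /= !big_ord_recl big_ord0 !balance_slack.
set s := `|_ / 2|.
rewrite !inE /=.
(* Of the two slack states only the first accepts; their equal masses [s] enter with opposite signs
   and cancel. *)
have -> : ((k + k + 0 < k) || (k + k + 0 == k + k))%N = true by lia.
have -> : ((k + k + bump 0 0 < k) || (k + k + bump 0 0 == k + k))%N = false.
  by rewrite /bump; lia.
have -> : (1%:R - 1 / 2) * s + ((0%:R - 1 / 2) * s + 0) = 0 by field.
rewrite addr0 -big_split mulr_sumr; apply: eq_bigr => i _ /=.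
rewrite /balance !col_mxEu spreadEl spreadEr !inE /= ltn_ord.
have -> : ((k + i < k) || (k + i == k + k))%N = false by have := ltn_ord i; lia.
rewrite normrM (ger0_norm (_ : 0 <= reject_weight i)) /reject_weight /=.
  by field.
by case: (_ \in _); rewrite /=; lra.
Qed.

Lemma balanced_bounded (y : 'cV[R]_k) (i : 'I_(k + k + 2)) :
  0 <= lambda <= 1 -> l1norm y <= 1 / 3 ->
  -1 <= balance (spread *m y) i 0 <= 1.
Proof.
move=> /andP[l0 l1] y3.
have rw j : 0 <= reject_weight j <= 2.
  by rewrite /reject_weight; case: (_ \in _); rewrite /=; lra.
rewrite -ler_norml; case: (split_ordP i) => {}i -> .
  rewrite /balance col_mxEu; case: (split_ordP i) => {}i ->.
    by rewrite spreadEl; have := ler_l1norm y i; lra.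
  rewrite spreadEr normrM ger0_norm; last by case/andP: (rw i).
  have /andP[h1 h2] := rw i.
  have h3 := ler_l1norm y i; have h4 := normr_ge0 (y i 0); nra.
rewrite balance_slack big_split_ord /= -big_split /=.
(* Each [y j 0] occurs with total weight [1 + reject_weight j], at most 3. With radius 1/3 the sum
   is at most 1 in absolute value, which puts the slack in [0, 1]. *)
have : `|\sum_j ((spread *m y) (lshift k j) 0 + (spread *m y) (rshift k j) 0)|
    <= 3 * l1norm y.
  rewrite (le_trans (ler_norm_sum _ _ _)) // /l1norm mulr_sumr.
  apply: ler_sum => j _; rewrite spreadEl spreadEr -[X in X + _]mul1r -mulrDl normrM.
  by rewrite ler_wpM2r // ger0_norm; have := rw j; lra.
by rewrite !ler_norml; lra.
Qed.

End BalancedAutomaton.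

Theorem proposition12 (R : realType) (Sigma : finType) (L : set (seq Sigma)) :
  AfL R L ->
  exists B : AfA R Sigma,
    L = afa_lang B (1 / 2) /\
    (forall (w : seq Sigma) (i : 'I_(afa_dim B)),
       -1 <= afa_state B w i 0 <= 1).
Proof.
move=> [A [lambda [lambda01 ->]]]; exists (balanced A lambda); split; last first.
  move=> w i; have [c [y [_ _ y3 ->]]] := balanced_stateE A lambda w.
  exact: balanced_bounded.
rewrite /afa_lang; congr mkset; apply: boolp.funext => w; congr (is_true _).
have [c [y [c_gt0 yE _ stE]]] := balanced_stateE A lambda w.
rewrite !lt_afa_value (balanced_margin stE) //.
(* The two margins differ only by the positive factor [c / 2], so they have the same sign. *)
have -> : \sum_(i < afa_dim A) ((i \in afa_acc A)%:R - lambda) * `|y i 0| =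
  c * \sum_(i < afa_dim A) ((i \in afa_acc A)%:R - lambda) * `|afa_state A w i 0|.
  rewrite mulr_sumr; apply: eq_bigr => i _.
  by rewrite yE mxE normrM gtr0_norm // mulrCA.
by rewrite mulrA pmulr_rgt0 // mulr_gt0 // divr_gt0.
Qed.
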